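(* Let $X$ be a metric space, let $G$ be a topological subgroup of $\mathrm{Iso}(X)$, and let $\mathscr{A}$ be a $G$-attractive and approximately $G$-invariant filter on $X$. Let $H$ be an amenable topological group and let $\psi \colon H \to G$ be a balanced homomorphism. If $G$ is $\mathscr{A}$-approximated by $\psi(H)$, then $G$ is skew-amenable.
   Context: For a topological group $G$, let $\mathscr{U}(G)$ be the set of neighborhoods of the neutral element, and for $g\in G$ let $\lambda_g\colon G\to G,\ x\mapsto gx$. $\mathrm{LUCB}(G)$ is the algebra of bounded functions $f\colon G\to\mathbb{R}$ that are left-uniformly continuous, i.e., for every $\epsilon>0$ there is $U\in\mathscr{U}(G)$ with $|f(x)-f(y)|\le\epsilon$ whenever $x^{-1}y\in U$. $\mathrm{RUCB}(G)$ is defined in the same way with $xy^{-1}\in U$ in place of $x^{-1}y\in U$. A mean on one of these algebras is a positive linear functional $\mu$ with $\mu(\mathbf 1)=1$; it is left-invariant if $\mu(f\circ\lambda_g)=\mu(f)$ for all $f$ and all $g\in G$. $G$ is skew-amenable if $\mathrm{LUCB}(G)$ admits a left-invariant mean. $G$ is amenable if every continuous action of $G$ on a non-void compact Hausdorff space admits an invariant regular Borel probability measure (equivalently, $\mathrm{RUCB}(G)$ admits a left-invariant mean). A homomorphism $\psi\colon H\to G$ of topological groups is balanced if $\bigcap_{g\in G}\psi^{-1}(g^{-1}Ug)\in\mathscr{U}(H)$ for every $U\in\mathscr{U}(G)$. $\mathrm{Iso}(X)$ is the group of all (bijective) isometries of the metric space $(X,d_X)$ with the topology of pointwise convergence with respect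 to the metric; a topological subgroup carries the subspace topology. For $A\subseteq X$ and $\epsilon>0$ let $B_X(A,\epsilon)=\{x\in X\mid\exists a\in A\colon d_X(x,a)<\epsilon\}$. For $G\leq\mathrm{Iso}(X)$: - a subset $A\subseteq X$ is $G$-attractive if for every $\epsilon>0$ and every finite $F\subseteq X$ there is $g\in G$ with $g(F)\subseteq B_X(A,\epsilon)$; - a filter $\mathscr{A}$ on $X$ is $G$-attractive if every member of $\mathscr{A}$ is $G$-attractive; - a filter $\mathscr{A}$ on $X$ is approximately $G$-invariant if $B_X(g(A),\epsilon)\in\mathscr{A}$ for all $A\in\mathscr{A}$, $g\in G$ and $\epsilon>0$; - $G$ is $\mathscr{A}$-approximated by a subgroup $K\leq G$ if for every $g\in G$ there is $h\in K$ such that for every $\epsilon>0$ there is $A\in\mathscr{A}$ with $\sup_{x\in A}d_X(gx,hx)<\epsilon$. *)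

(* Defs.v *)
From HB Require Import structures.
From mathcomp Require Import all_boot all_order all_algebra.
From mathcomp Require Import all_classical all_reals.
From mathcomp Require Import ereal topology normedtype measure.

Set Implicit Arguments.
Unset Strict Implicit.
Unset Printing Implicit Defensive.

Import Order.TTheory GRing.Theory Num.Theory.
Import numFieldNormedType.Exports.
Import metricType_numDomainType.

Local Open Scope classical_set_scope.
Local Open Scope ring_scope.

HB.mixin Record isTopologicalGroup G & Group G & Topological G := {
  mulg_continuous : continuous (fun z : G * G => (z.1 * z.2)%g) ;
  invg_continuous : continuous (fun x : G => (x^-1)%g)
}.

#[short(type="topologicalGroupType")]
HB.structure Definition TopologicalGroup :=
  {G of isTopologicalGroup G & Group G & Topological G}.

Section Subgroup.
Context {T : topologicalGroupType} (G : groupClosed T).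

Definition subgroup : Type := {x : T | x \in G}.

HB.instance Definition _ := SubChoice.on subgroup.

Let subgroup_closed : group_closed (fun x : T => x \in G).
Proof. by split; [exact: gpred1 | move=> x y; exact: gpredF]. Qed.

HB.instance Definition _ :=
  SubChoice_isSubGroup.Build T _ subgroup subgroup_closed.

HB.instance Definition _ :=
  Topological.copy subgroup (initial_topology (val : subgroup -> T)).

Let val_continuous : continuous (val : subgroup -> T).
Proof. exact: initial_continuous. Qed.

Let subgroup_mulg_continuous :
  continuous (fun z : subgroup * subgroup => (z.1 * z.2)%g).
Proof.
apply: (@continuous_comp_initial subgroup _ T val) => -[x y].
apply: (@continuous2_cvg _ _ _ _ _ _ (val \o fst) (val \o snd)
  (fun a b : T => (a * b)%g)); first exact: (@mulg_continuous T (_, _)).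
- by apply: cvg_comp; [exact: cvg_fst | exact: val_continuous].
- by apply: cvg_comp; [exact: cvg_snd | exact: val_continuous].
Qed.

Let subgroup_invg_continuous : continuous (fun x : subgroup => (x^-1)%g).
Proof.
apply: (@continuous_comp_initial subgroup _ T val) => x.
apply: (cvg_comp (G := nbhs (val x)) val (fun y : T => (y^-1)%g)).
  exact: val_continuous.
exact: invg_continuous.
Qed.

HB.instance Definition _ := isTopologicalGroup.Build subgroup
  subgroup_mulg_continuous subgroup_invg_continuous.

End Subgroup.

Section Isometries.
Context {R : realType} (X : metricType R).

Record Iso := MkIso {
  iso_fun :> X -> X ;
  iso_mdist : forall x y, mdist (iso_fun x) (iso_fun y) = mdist x y ;
  iso_bij : bijective iso_fun
}.

Lemma iso_eq (f g : Iso) : f =1 g -> f = g.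
Proof.
case: f g => [f fd fb] [g gd gb] /= /funext fg; case: _ / fg in gd gb *.
by congr MkIso; exact: Prop_irrelevance.
Qed.

HB.instance Definition _ := gen_eqMixin Iso.
HB.instance Definition _ := gen_choiceMixin Iso.

Definition iso_one : Iso :=
  @MkIso id (fun _ _ => erefl) (Bijective (fun=> erefl) (fun=> erefl)).

Let comp_mdist (f g : Iso) x y :
  mdist ((f \o g) x) ((f \o g) y) = mdist x y.
Proof. by rewrite /= !iso_mdist. Qed.

Definition iso_mul (f g : Iso) : Iso :=
  MkIso (comp_mdist f g) (bij_comp (iso_bij f) (iso_bij g)).

Let inv_exists (f : Iso) : exists g : Iso, cancel f g /\ cancel g f.
Proof.
have [g fK gK] := iso_bij f.
have gd x y : mdist (g x) (g y) = mdist x y.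
  by rewrite -(iso_mdist f) !gK.
by exists (MkIso gd (Bijective gK fK)).
Qed.

Definition iso_inv (f : Iso) : Iso := sval (cid (inv_exists f)).

Lemma iso_invK (f : Iso) : cancel f (iso_inv f).
Proof. by rewrite /iso_inv; case: cid => g []. Qed.

Lemma iso_invKV (f : Iso) : cancel (iso_inv f) f.
Proof. by rewrite /iso_inv; case: cid => g []. Qed.

Let iso_mulA : associative iso_mul.
Proof. by move=> f g h; exact: iso_eq. Qed.
Let iso_1mul : left_id iso_one iso_mul.
Proof. by move=> f; exact: iso_eq. Qed.
Let iso_mul1 : right_id iso_one iso_mul.
Proof. by move=> f; exact: iso_eq. Qed.
Let iso_Vmul : left_inverse iso_one iso_inv iso_mul.
Proof. by move=> f; apply: iso_eq => x; exact: iso_invK. Qed.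
Let iso_mulV : right_inverse iso_one iso_inv iso_mul.
Proof. by move=> f; apply: iso_eq => x; exact: iso_invKV. Qed.

HB.instance Definition _ := isGroup.Build Iso
  iso_mulA iso_1mul iso_mul1 iso_Vmul iso_mulV.

Definition iso_ptws (f : Iso) : {ptws X -> X} := f.

HB.instance Definition _ :=
  Topological.copy Iso (initial_topology iso_ptws).

Lemma Iso_continuous (Y : topologicalType) (F : Y -> Iso) :
  (forall x, continuous (fun y => F y x)) -> continuous F.
Proof.
move=> cF; apply: (@continuous_comp_initial Iso _ _ iso_ptws) => y.
by apply/pointwise_cvgP => x; exact: cF.
Qed.

Let iso_cvg (f : Iso) (x : X) : (fun g : Iso => g x) @ f --> f x.
Proof.
have : iso_ptws g @[g --> f] --> iso_ptws f by exact: initial_continuous.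
by move/(iffLR (pointwise_cvgP _ (fmap_filter _ (nbhs_filter f))))/(_ x).
Qed.

Let iso_mulg_continuous :
  continuous (fun z : Iso * Iso => (z.1 * z.2)%g).
Proof.
apply: Iso_continuous => x -[f g].
apply/cvgrPdist_lt => e e0 /=.
have e20 : 0 < e / 2 by rewrite divr_gt0.
have fP : \forall h \near nbhs f, mdist (f (g x)) ((h : Iso) (g x)) < e / 2 :=
  cvgr_dist_lt (@iso_cvg f (g x)) e20.
have gP : \forall h \near nbhs g, mdist (g x) ((h : Iso) x) < e / 2 :=
  cvgr_dist_lt (@iso_cvg g x) e20.
exists ([set h : Iso | mdist (f (g x)) (h (g x)) < e / 2],
        [set h : Iso | mdist (g x) (h x) < e / 2]).
  by split; [exact: fP | exact: gP].
move=> [h k] /= [hP kP].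
rewrite (le_lt_trans (metric_triangle _ (h (g x)) _))// (splitr e) ltrD//.
by rewrite (iso_mdist h).
Qed.

Let iso_invg_continuous : continuous (fun f : Iso => (f^-1)%g).
Proof.
apply: Iso_continuous => x f.
apply: (iffRL (@cvgrPdist_lt _ _ Iso (nbhs f) _ _ _)) => e e0.
have fP : \forall h \near nbhs f,
    mdist (f (iso_inv f x)) ((h : Iso) (iso_inv f x)) < e :=
  cvgr_dist_lt (@iso_cvg f (iso_inv f x)) e0.
near=> h.
rewrite -(iso_mdist h (iso_inv f x)) (iso_invKV h).
rewrite metric_sym -{1}(iso_invKV f x); near: h; exact: fP.
Unshelve. all: by end_near.
Qed.

HB.instance Definition _ := isTopologicalGroup.Build Iso
  iso_mulg_continuous iso_invg_continuous.

End Isometries.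

Section SkewAmenability.
Context {R : realType} {G : topologicalGroupType}.

Definition left_uniformly_continuous (f : G -> R) := forall e : R, 0 < e ->
  exists2 U : set G, nbhs 1%g U &
    forall x y, U (x^-1 * y)%g -> `|f x - f y| <= e.

Definition LUCB : set (G -> R) :=
  [set f | bounded_fun f /\ left_uniformly_continuous f].

(* Only the values of mu on the algebra E matter. *)
Definition mean (E : set (G -> R)) (mu : (G -> R) -> R) :=
  [/\ forall (a : R) f g, E f -> E g ->
        mu (fun x => a * f x + g x) = a * mu f + mu g,
      forall f, E f -> (forall x, 0 <= f x) -> 0 <= mu f &
      mu (fun=> 1) = 1].

Definition left_invariant (E : set (G -> R)) (mu : (G -> R) -> R) :=
  forall f (g : G), E f -> mu (fun x => f (g * x)%g) = mu f.

End SkewAmenability.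

Definition skew_amenable (R : realType) (G : topologicalGroupType) :=
  exists mu : (G -> R) -> R, mean LUCB mu /\ left_invariant LUCB mu.

Notation borel T := (g_sigma_algebraType (@open T)).

Definition regular_measure (R : realType) (T : ptopologicalType)
    (mu : set T -> \bar R) :=
  forall B : set (borel T), measurable B ->
    mu B = ereal_inf [set mu U | U in [set U | open U /\ B `<=` U]] /\
    mu B = ereal_sup [set mu K | K in [set K | compact K /\ K `<=` B]].

Definition continuous_action (G : topologicalGroupType) (T : topologicalType)
    (act : G -> T -> T) :=
  [/\ forall t, act 1%g t = t,
      forall g h t, act (g * h)%g t = act g (act h t) &
      continuous (fun z : G * T => act z.1 z.2)].

(* A ptopologicalType is pointed, hence non-void. *)
Definition amenable (R : realType) (G : topologicalGroupType) :=
  forall (T : ptopologicalType) (act : G -> T -> T),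
    compact [set: T] -> hausdorff_space T -> continuous_action act ->
    exists mu : probability (borel T) R,
      regular_measure mu /\
      forall (g : G) (B : set (borel T)), measurable B ->
        mu (act g @^-1` B) = mu B.

(* No continuity is required of psi: it follows from the case g = 1. *)
Definition balanced (H G : topologicalGroupType) (psi : H -> G) :=
  forall U : set G, nbhs 1%g U ->
    nbhs 1%g (\bigcap_g psi @^-1` [set (g^-1 * u * g)%g | u in U]).

Section Filters.
Context {R : realType} {X : metricType R}.

Definition mball (A : set X) (e : R) : set X :=
  [set x | exists2 a, A a & mdist x a < e].

Context (G : groupClosed (Iso X)).

Definition attractive (A : set X) :=
  forall (e : R) (F : set X), 0 < e -> finite_set F ->
    exists g : subgroup G, val g @` F `<=` mball A e.

Definition attractive_filter (A : set_system X) :=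
  forall B, A B -> attractive B.

Definition approx_invariant (A : set_system X) :=
  forall (B : set X) (g : subgroup G) (e : R), A B -> 0 < e ->
    A (mball (val g @` B) e).

(* The supremum is taken in \bar R, so that it is +oo on an unbounded set; on
   the empty set it is -oo instead of 0, which changes nothing as e > 0. *)
Definition approximated (A : set_system X) (K : set (subgroup G)) :=
  forall g : subgroup G, exists2 h : subgroup G, K h &
    forall e : R, 0 < e -> exists2 B : set X, A B &
      (ereal_sup [set (mdist (val g x) (val h x))%:E | x in B] < e%:E)%E.

End Filters.

(* Main.v *)
Require Import Defs.
From HB Require Import structures.
From mathcomp Require Import all_boot all_order all_algebra.
From mathcomp Require Import all_classical all_reals.
From mathcomp Require Import ereal topology normedtype measure.
From mathcomp Require Import lebesgue_stieltjes_measure measurable_realfun.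
From mathcomp Require Import lebesgue_integral.
From mathcomp Require Import ring.

Set Implicit Arguments.
Unset Strict Implicit.
Unset Printing Implicit Defensive.

Import Order.TTheory GRing.Theory Num.Theory.
Import numFieldNormedType.Exports.

Local Open Scope classical_set_scope.

(** The mean is obtained by integrating over a compact space of limit points
on which an element of [G] cannot be told apart from a suitable element of
[psi H].

Embed [G] into the product of copies of the real line indexed by [LUCB G],
sending [x] to the evaluation at [x].  For a filter [F] on [G], let [S] be the
set of cluster points of [F] in this product: by boundedness and Tychonoff it is
compact, and every [p] in [S] is a positive, unital linear functional on
[LUCB G].  Assume three things.
- [F] is stable under left translation by [psi h], for every [h] in [H].  Then
  [H] acts on [S] by [(h p)(f) = p (f o lambda_(psi h))].
- [psi] is balanced.  Then [f (psi h x)] depends continuously on [h], uniformly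
  in [x] ([balanced_translate_continuous]), because
  [(psi h0 x)^-1 (psi h x) = x^-1 psi (h0^-1 h) x] is close to 1 uniformly in
  [x].  As each [p] is a contraction for the uniform norm, the action of [H] on
  [S] is jointly continuous ([translate_limit_action]).
- Each [g] in [G] has a companion [h] in [H] such that [g x] and [psi h x] are
  asymptotically equal for the left uniformity as [x] runs along [F].  Then
  [p (f o lambda_g) = p (f o lambda_(psi h))] for all [p] in [S] and [f].
Amenability of [H] yields an [H]-invariant probability measure on [S], and
integrating [p f] over it gives a mean which is [psi H]-invariant, hence by the
third point [G]-invariant.  This is [skew_amenable_of_balanced].

For isometries, [F] is the filter of those [g] that push a given finite set
close to a given member of the filter [A] on [X] ([attracting]).  Attractivity
makes [F] proper and approximate invariance makes it stable under left
translations.  As for companions: [g] and [h] being [A]-close, if [x] pushes a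
finite set into a small neighborhood of a set where [g] and [h] nearly agree,
then [g x] and [h x] nearly agree on this finite set, so that
[(g x)^-1 (h x)] nearly fixes it; finite sets and tolerances describe the
neighborhoods of 1 in the pointwise topology ([subgroup_nbhs1]). *)

Local Open Scope ring_scope.

(** * Initial, product and subset topologies *)

Lemma initial_cvg {S : choiceType} {T : topologicalType} (f : S -> T)
    (F : set_system S) (s : S) : Filter F ->
  f @ F --> f s -> F --> (s : initial_topology f).
Proof.
move=> FF fF U [_ [[W oW <-] Ws] WU].
apply: (filterS WU); apply: fF; exact: open_nbhs_nbhs.
Qed.

Lemma ptws_cvg {Y : Type} {V : topologicalType} {I : Type} (F : set_system Y)
    (Phi : Y -> {ptws I -> V}) (l : {ptws I -> V}) : Filter F ->
  (forall i, (fun y => Phi y i) @ F --> l i) -> Phi @ F --> l.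
Proof.
move=> FF cPhi; apply/cvg_sup => i U [_ [[W oW <-] Wl] WU].
apply: (filterS (F := F) (P := [set y | W (Phi y i)])).
  by move=> y; exact: WU.
by apply: cPhi; exact: open_nbhs_nbhs.
Qed.

Lemma ptws_continuous {Y V : topologicalType} {I : Type}
    (Phi : Y -> {ptws I -> V}) :
  (forall i, continuous (fun y => Phi y i)) -> continuous Phi.
Proof. by move=> cPhi y; apply: ptws_cvg => i; exact: cPhi. Qed.

Lemma hausdorff_ptws {I : Type} {V : topologicalType} :
  hausdorff_space V -> hausdorff_space {ptws I -> V}.
Proof. by move=> hV; apply: (@hausdorff_product {classic I} (fun=> V)). Qed.

Lemma compact_set_type {X : topologicalType} (A : set X) :
  compact A -> compact [set: A].
Proof.
move=> Ac FA PF _.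
have SA : (set_val @ FA) A by apply: nearW => p; exact: set_valP.
have [q [Aq clq]] := Ac _ _ SA.
exists (exist _ q (mem_set Aq)); split => // B C FB [_ [[W oW <-] Wq] WC].
have /clq : (set_val @ FA) (set_val @` B).
  by apply: (filterS (F := FA) _ FB) => p Bp; exists p.
move=> /(_ W (open_nbhs_nbhs (conj oW Wq)))[_ [[p Bp <-] Wp]].
by exists p; split => //; exact: WC.
Qed.

Lemma hausdorff_set_type {X : topologicalType} (A : set X) :
  hausdorff_space X -> hausdorff_space A.
Proof.
move=> hX p q pq; apply: val_inj; apply: hX => B C pB qC.
have cv : continuous (set_val : A -> X) by exact: initial_continuous.
have [r [Br Cr]] := pq _ _ (cv p B pB) (cv q C qC).
by exists (set_val r).
Qed.

(** * Limits of evaluations along a filter *)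

Section LimitEvaluations.
Context {R : realType} {T : Type} {E : set (T -> R)}.

Definition eval_at (t : T) : {ptws E -> R} := fun f => set_val f t.

Definition limit_evaluations (F : set_system T) : set {ptws E -> R} :=
  cluster (eval_at @ F).

Lemma coord_continuous (f : E) : continuous (fun p : {ptws E -> R} => p f).
Proof. exact: (@proj_continuous {classic E} (fun=> R) f). Qed.

(** The transfer principle behind all the laws below: a closed condition that
holds for evaluations along the filter passes to their limits. *)
Lemma limit_evaluations_sub_closed (F : set_system T) (C : set {ptws E -> R}) :
  closed C -> (\forall t \near F, C (eval_at t)) ->
  limit_evaluations F `<=` C.
Proof. by move=> cC FC p Fp; apply: cC => B pB; exact: Fp. Qed.

Lemma closed_limit_evaluations (F : set_system T) :
  closed (limit_evaluations F).
Proof.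
rewrite /limit_evaluations clusterE.
by apply: closed_bigI => A _; exact: closed_closure.
Qed.

Lemma limit_evaluations_coord_continuous (F : set_system T) (f : E) :
  continuous (fun p : limit_evaluations F => set_val p f).
Proof.
move=> p; apply: (@continuous_comp (limit_evaluations F) {ptws E -> R} R
  set_val (fun q => q f)); first exact: initial_continuous.
exact: coord_continuous.
Qed.

Context (Eb : forall f, E f -> bounded_fun f).

(** All evaluations lie in a product of segments, which Tychonoff makes compact;
so their cluster points form a closed subset of it. *)
Lemma limit_evaluations_compact (F : set_system T) : ProperFilter F ->
  compact (limit_evaluations F) /\ limit_evaluations F !=set0.
Proof.
move=> PF.
have /choice[M Mb] (f : E) : exists M : R, forall t, `|set_val f t| <= M.
  have [M [_ MP]] := Eb (set_valP f).
  by exists (M + 1) => t; apply: MP => //; rewrite ltrDl.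
pose box : set {ptws E -> R} :=
  [set p | forall f, `[- M f, M f]%classic (p f)].
have box_compact : compact box.
  apply: (@tychonoff {classic E} (fun=> R) (fun f => `[- M f, M f]%classic)).
  by move=> f; exact: segment_compact.
have evF : (eval_at @ F) box.
  by apply: nearW => t f /=; rewrite in_itv /= -ler_norml; exact: Mb.
have sub : limit_evaluations F `<=` box.
  apply: limit_evaluations_sub_closed evF.
  by apply: compact_closed box_compact; exact: hausdorff_ptws (@Rhausdorff R).
split.
  by apply: subclosed_compact sub => //; exact: closed_limit_evaluations.
by have [p [_]] := box_compact _ _ evF; exists p.
Qed.

End LimitEvaluations.

Section LimitLaws.
Context {R : realType} {T : Type} {E : set (T -> R)}.
Context (F : set_system T) {FF : Filter F} (p : {ptws E -> R}).
Context (Fp : limit_evaluations F p).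

Let closed_law (Phi : {ptws E -> R} -> R) (C : set R) : continuous Phi ->
  closed C -> (\forall t \near F, C (Phi (eval_at t))) -> C (Phi p).
Proof.
move=> cPhi cC FC.
have : closed (Phi @^-1` C) by exact: (iffLR (continuous_closedP Phi) cPhi).
by move/limit_evaluations_sub_closed => /(_ F FC p Fp).
Qed.

Lemma limit_evaluation_linear (f g h : E) (a : R) :
  (forall t, set_val h t = a * set_val f t + set_val g t) ->
  p h = a * p f + p g.
Proof.
move=> hE; apply/eqP; rewrite -subr_eq0; apply/eqP.
apply: (@closed_law (fun q => q h - (a * q f + q g)) [set 0]).
- move=> q; apply: (@cvgB _ R _ (nbhs q) _ (fun q => q h)
    (fun q => a * q f + q g)); first exact: coord_continuous.
  apply: (@cvgD _ R _ (nbhs q) _ (fun q => a * q f) (fun q => q g));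
    last exact: coord_continuous.
  apply: (@cvgM R _ (nbhs q) _ (fun=> a) (fun q => q f)); first exact: cvg_cst.
  exact: coord_continuous.
- exact: closed_eq.
- by apply: nearW => t /=; rewrite /eval_at hE subrr.
Qed.

Lemma limit_evaluation_ge0 (f : E) : (forall t, 0 <= set_val f t) -> 0 <= p f.
Proof.
move=> f0; apply: (@closed_law (fun q => q f) [set x | 0 <= x]).
- exact: coord_continuous.
- exact: closed_ge.
- exact: nearW.
Qed.

Lemma limit_evaluation_cst (f : E) (c : R) :
  (forall t, set_val f t = c) -> p f = c.
Proof.
move=> fE; apply: (@closed_law (fun q => q f) [set c]).
- exact: coord_continuous.
- exact: closed_eq.
- exact: nearW.
Qed.

(** With the estimate holding everywhere this is contractivity for the uniform
norm; with it holding only along the filter, it shows that a limit cannot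
separate functions that agree asymptotically. *)
Lemma limit_evaluation_dist_le (f g : E) (c : R) :
  (\forall t \near F, `|set_val f t - set_val g t| <= c) -> `|p f - p g| <= c.
Proof.
move=> fg; apply: (@closed_law (fun q => `|q f - q g|) [set x | x <= c]) => //.
move=> q; apply: (@cvg_norm R R _ (nbhs q) _ (fun q => q f - q g)).
by apply: (@cvgB _ R _ (nbhs q) _ (fun q => q f) (fun q => q g));
  exact: coord_continuous.
Qed.

End LimitLaws.

Section Pullback.
Context {R : realType} {T : Type} {E : set (T -> R)}.
Context (s : T -> T) (Es : forall f, E f -> E (f \o s)).

Definition precompose (f : E) : E :=
  exist _ (set_val f \o s) (mem_set (Es (set_valP f))).

(** The continuous extension of [s] to limits: it sends the evaluation at [t] to
the evaluation at [s t]. *)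
Definition pull (p : {ptws E -> R}) : {ptws E -> R} := p \o precompose.

Lemma pull_continuous : continuous pull.
Proof. by apply: ptws_continuous => f; exact: coord_continuous. Qed.

Lemma pull_limit_evaluations (F : set_system T) : F `<=` s @ F ->
  limit_evaluations F `<=` pull @^-1` limit_evaluations F.
Proof.
move=> sF p Fp A B /sF FA pB.
have [q [Aq Bq]] := Fp (pull @^-1` A) _ FA (@pull_continuous p B pB).
by exists (pull q).
Qed.

End Pullback.

(** * Integrating continuous functions against Borel probability measures *)

Section BorelIntegral.
Context {R : realType} {T : ptopologicalType}.

Lemma continuous_borel_measurable (f : T -> R) :
  continuous f -> measurable_fun [set: borel T] (f : borel T -> R).
Proof.
move=> /continuousP cf; apply: (measurability _ (RGenOpens.measurableE R)).
move=> _ [_ [a [b ->] <-]]; rewrite setTI; apply: sub_sigma_algebra.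
exact/cf/interval_open.
Qed.

Lemma continuous_borel_measurable_map (s : T -> T) :
  continuous s -> measurable_fun [set: borel T] (s : borel T -> borel T).
Proof.
move=> /continuousP cs; apply: measurability => //.
move=> _ [B oB <-]; rewrite setTI; apply: sub_sigma_algebra.
exact: cs.
Qed.

Context (mu : probability (borel T) R) (Tc : compact [set: T]).

Lemma continuous_integrable (f : T -> R) : continuous f ->
  mu.-integrable [set: borel T] (EFin \o f).
Proof.
move=> cf; apply: measurable_bounded_integrable => //.
- by rewrite (le_lt_trans (probability_le1 _ _)) ?ltry.
- exact: continuous_borel_measurable.
- have : compact (f @` [set: T]).
    by apply: continuous_compact => //; exact: continuous_subspaceT.
  move=> /compact_bounded[M [Mr MP]]; exists M; split => // y My t _.
  by apply: (MP y My); exists t.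
Qed.

Lemma Rintegral_measure_preserving (s : T -> T) (f : T -> R) :
  continuous s -> continuous f ->
  (forall B : set (borel T), measurable B -> mu (s @^-1` B) = mu B) ->
  (\int[mu]_t f (s t) = \int[mu]_t f t)%R.
Proof.
move=> cs cf smu; rewrite /Rintegral; congr fine.
have ms := continuous_borel_measurable_map cs.
have mf : measurable_fun [set: borel T] (EFin \o f).
  by apply/measurable_EFinP; exact: continuous_borel_measurable.
have cfs : continuous (f \o s).
  by move=> t; apply: continuous_comp; [exact: cs | exact: cf].
have := integral_pushforward ms mf (continuous_integrable cfs) measurableT.
rewrite preimage_setT => <-.
by apply: eq_measure_integral => B mB _; exact: smu.
Qed.

End BorelIntegral.

(** * Bounded left-uniformly continuous functions *)

Section LUCB.
Context {R : realType} {G : topologicalGroupType}.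
Implicit Types f : G -> R.

Lemma LUCB_cst (c : R) : LUCB (fun _ : G => c).
Proof.
split; first exact: bounded_cst.
move=> e e0; exists setT => [|x y _]; first exact: filterT.
by rewrite subrr normr0 ltW.
Qed.

Lemma LUCB_translate (g : G) f : LUCB f -> LUCB (f \o (fun x => g * x)%g).
Proof.
move=> [[M [Mr Mf]] uf]; split.
  by exists M; split => // y My x _; exact: (Mf y My (g * x)%g).
move=> e /uf[U U1 Uf]; exists U => // x y Uxy; apply: Uf.
by rewrite invgM -mulgA mulKg.
Qed.

Lemma LUCB_linear (a : R) f g :
  LUCB f -> LUCB g -> LUCB (fun x => a * f x + g x).
Proof.
move=> [bf uf] [bg ug]; split.
  have [M [_ Mf]] := bf; have [N [_ Ng]] := bg.
  exists (`|a| * (M + 1) + (N + 1)); split; first exact: num_real.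
  move=> y My x _ /=.
  apply: le_trans (ltW My); apply: (le_trans (ler_normD _ _)).
  rewrite normrM lerD ?ler_wpM2l//; first by apply: Mf => //; rewrite ltrDl.
  by apply: Ng => //; rewrite ltrDl.
move=> e e0.
(* adding 1 to the modulus of a keeps the tolerance for f positive if a = 0 *)
have d0 : 0 < e / 2 / (`|a| + 1) by rewrite !divr_gt0// ltr_wpDl.
have [U U1 Uf] := uf _ d0.
have [V V1 Vg] := ug (e / 2) (divr_gt0 e0 (ltr0Sn _ 1)).
exists (U `&` V); first exact: filterI.
move=> x y [/Uf fxy /Vg gxy].
have -> : a * f x + g x - (a * f y + g y) = a * (f x - f y) + (g x - g y).
  by rewrite opprD addrACA mulrBr.
rewrite (le_trans (ler_normD _ _))// (splitr e) lerD// normrM.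
apply: (@le_trans _ _ ((`|a| + 1) * (e / 2 / (`|a| + 1)))).
  by rewrite ler_pM// lerDl.
by rewrite mulrC divfK// gt_eqF// ltr_wpDl.
Qed.

End LUCB.

(** * Balanced homomorphisms and invariant means *)

Section BalancedAction.
Context {R : realType} {G H : topologicalGroupType}.
Context (psi : {multiplicative H -> G}) (psi_balanced : balanced psi).

(** Left-uniform continuity of [f] controls [f (psi h0 x) - f (psi h x)] through
the conjugate [x^-1 psi (h0^-1 h) x]; being balanced is what makes this
conjugate close to 1 for all [x] at once. *)
Lemma balanced_translate_continuous (f : G -> R) (h0 : H) (e : R) :
  left_uniformly_continuous f -> 0 < e ->
  \forall h \near h0, forall x, `|f (psi h0 * x)%g - f (psi h * x)%g| <= e.
Proof.
move=> uf e0; have [U U1 Uf] := uf _ e0.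
have : (fun h => h0^-1 * h)%g @ nbhs h0 --> (1%g : H).
  rewrite -(mulVg h0).
  apply: (@continuous2_cvg _ _ _ _ _ _ (fun=> h0^-1%g) id
    (fun a b : H => (a * b)%g)); first exact: (@mulg_continuous H (_, _)).
    exact: cvg_cst.
  exact: cvg_id.
move=> /(_ _ (psi_balanced U1)) near_h0.
apply: (filterS (F := nbhs h0) _ near_h0) => h /= Uh x.
have [u Uu uE] := Uh x^-1%g I.
have -> : (psi h * x = psi h0 * x * u)%g.
  by rewrite -{1}(mulVKg h0 h) gmulfM -uE invgK -!mulgA mulVg mulg1.
by apply: Uf; rewrite mulKg.
Qed.

Context (F : set_system G) {FF : Filter F}.
Context (F_stable : forall h, F `<=` (fun x => psi h * x)%g @ F).

Let S : set {ptws (@LUCB R G) -> R} := limit_evaluations F.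

Definition translate_limit (h : H) (p : S) : S :=
  exist _ (pull (LUCB_translate (psi h)) (set_val p))
    (mem_set (pull_limit_evaluations (Es := LUCB_translate (psi h))
      (F_stable h) (set_valP p))).

(** For joint continuity, move [h] first: contractivity of [p] bounds the change
by a uniform distance between translates of [f], whatever [p] is.  Then move [p]
with the function fixed, which is continuity of a coordinate. *)
Lemma translate_limit_action : continuous_action translate_limit.
Proof.
split.
- move=> p; apply: val_inj; apply/funext => f /=.
  rewrite /pull /=; congr (set_val p _); apply: val_inj; apply/funext => x /=.
  have -> : psi 1%g = 1%g by apply: (mulgI (psi 1%g)); rewrite -gmulfM !mulg1.
  by rewrite mul1g.
- move=> g h p; apply: val_inj; apply/funext => f /=.
  rewrite /pull /=; congr (set_val p _); apply: val_inj; apply/funext => x /=.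
  by rewrite gmulfM -mulgA.
apply: (@continuous_comp_initial _ _ _ (set_val : S -> _)).
apply: ptws_continuous => f -[h0 p0].
apply/cvgrPdist_le => e e0.
have e20 : 0 < e / 2 by rewrite divr_gt0.
pose f0 := precompose (LUCB_translate (psi h0)) f.
have pc : (fun p : S => set_val p f0) @ nbhs p0 --> set_val p0 f0.
  exact: limit_evaluations_coord_continuous.
have [_ uf] := set_valP f.
exists ([set h | forall x,
    `|set_val f (psi h0 * x)%g - set_val f (psi h * x)%g| <= e / 2],
  [set p : S | `|set_val p0 f0 - set_val p f0| <= e / 2]).
  split; first exact: balanced_translate_continuous uf e20.
  by move/cvgrPdist_le : pc => /(_ _ e20).
move=> [h p] /= [hh hp].
rewrite [e]splitr (le_trans (ler_distD (set_val p f0) _ _))// lerD//.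
by apply: (limit_evaluation_dist_le (set_valP p)); apply: nearW.
Qed.

End BalancedAction.

(** The two conditions on [F] make the space of limits along [F] invariant under
[H] and make [g] and its companion [psi h] act on it in the same way; so an
[H]-invariant measure on this space is seen as invariant by all of [G]. *)
Theorem skew_amenable_of_balanced (R : realType) (G H : topologicalGroupType)
    (psi : {multiplicative H -> G}) (F : set_system G) :
  ProperFilter F -> amenable R H -> balanced psi ->
  (forall h, F `<=` (fun x => psi h * x)%g @ F) ->
  (forall g, exists h, forall U, nbhs 1%g U ->
     \forall x \near F, U ((g * x)^-1 * (psi h * x))%g) ->
  skew_amenable R G.
Proof.
move=> PF Ham bal Fst Fapp.
have [Sc [p0 p0S]] := limit_evaluations_compact
  (fun f (Ef : @LUCB R G f) => proj1 Ef) PF.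
set S := limit_evaluations F in Sc p0S.
pose T : ptopologicalType := HB.pack_for ptopologicalType (set_type S)
  (isPointed.Build (set_type S) (exist _ p0 (mem_set p0S))).
have Tc : compact [set: T] by exact: compact_set_type.
have Th : hausdorff_space T.
  by apply: hausdorff_set_type; exact: hausdorff_ptws (@Rhausdorff R).
have [nu [_ nu_inv]] := Ham T _ Tc Th (translate_limit_action bal Fst).
have cE (f : @LUCB R G) : continuous (fun p : T => set_val p f).
  exact: limit_evaluations_coord_continuous.
have iE f : nu.-integrable [set: borel T] (EFin \o (fun p : T => set_val p f)).
  exact: continuous_integrable.
pose mu (f : G -> R) := if pselect (LUCB f) is left Ef
  then (\int[nu]_p (set_val p (exist _ f (mem_set Ef))))%R else 0.
have muE (f : @LUCB R G) : mu (set_val f) = (\int[nu]_p set_val p f)%R.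
  rewrite /mu; case: pselect => [Ef|/(_ (set_valP f))//].
  by congr Rintegral; apply/funext => p; congr (set_val p _); exact: val_inj.
pose lift f (Ef : LUCB f) : @LUCB R G := exist _ f (mem_set Ef).
have muL f (Ef : LUCB f) : mu f = (\int[nu]_p set_val p (lift f Ef))%R.
  exact: (muE (lift f Ef)).
exists mu; split; first split.
- move=> a f g Ef Eg.
  rewrite (muL _ (LUCB_linear a Ef Eg)) (muL _ Ef) (muL _ Eg).
  rewrite -RintegralZl// -RintegralD//; last first.
    exact: (integrableZl measurableT a (iE (lift f Ef))).
  apply: eq_Rintegral => p _.
  exact: (limit_evaluation_linear (set_valP p)).
- move=> f Ef f0; rewrite (muL _ Ef); apply: Rintegral_ge0 => p _.
  exact: (limit_evaluation_ge0 (set_valP p)).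
- rewrite (muL _ (LUCB_cst 1)).
  transitivity (\int[nu]_(p in setT) (1 : R))%R; last first.
    rewrite Rintegral_cst// mul1r.
    exact: (congr1 fine (probability_setT nu)).
  apply: eq_Rintegral => p _.
  exact: (limit_evaluation_cst (set_valP p)).
- move=> f g Ef; rewrite (muL _ (LUCB_translate g Ef)) (muL _ Ef).
  have [h hP] := Fapp g.
  (* trade g for psi h under the integral, then use the invariance of nu *)
  transitivity (\int[nu]_p
      (set_val (translate_limit Fst h p : S) (lift f Ef)))%R.
    apply: eq_Rintegral => p _; apply/eqP.
    rewrite -subr_eq0 -normr_le0; apply/ler_addgt0Pr => e e0; rewrite add0r.
    apply: (limit_evaluation_dist_le (set_valP p)).
    have [U U1 Uf] := (proj2 Ef) _ e0.
    by apply: filterS (hP _ U1) => x; exact: Uf.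
  apply: (@Rintegral_measure_preserving R T nu Tc (translate_limit Fst h)
    (fun p => set_val p (lift f Ef))) => //.
    have [_ _ ac] := translate_limit_action (R := R) bal Fst.
    move=> p U pU; have [[B C] /= [hB pC] BC] := ac (h, p) U pU.
    apply: filterS pC => q Cq; apply: (BC (h, q)); split => //=.
    exact: nbhs_singleton.
  exact: nu_inv.
Qed.

(** * Groups of isometries *)

Import metricType_numDomainType.

Section IsometryGroup.
Context {R : realType} {X : metricType R} {G : groupClosed (Iso X)}.

(** The sets on the right form a filter which converges to 1, since it does so
at every point of [X]; convergence says that this filter refines the
neighborhoods of 1, and spares a description of the open sets of the product. *)
Lemma subgroup_nbhs1 (U : set (subgroup G)) : nbhs (1%g : subgroup G) U ->
  exists (F : set X) (e : R), [/\ finite_set F, 0 < e &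
    forall g : subgroup G, (forall x, F x -> mdist x (val g x) < e) -> U g].
Proof.
pose D := [set Fe : set X * R | finite_set Fe.1 /\ 0 < Fe.2].
pose C (Fe : set X * R) :=
  [set g : subgroup G | forall x, Fe.1 x -> mdist x (val g x) < Fe.2].
have FF : Filter (filter_from D C).
  apply: filter_from_filter; first by exists (set0, 1); split => /=.
  move=> [F1 e1] [F2 e2] [/= F1f e10] [/= F2f e20].
  exists (F1 `|` F2, Num.min e1 e2).
    by split => /=; [rewrite finite_setU | rewrite lt_min e10].
  move=> g /= Cg; split => x Fx; apply: lt_le_trans (Cg x _) _.
  - by left.
  - by rewrite ge_min lexx.
  - by right.
  - by rewrite ge_min lexx orbT.
suff : filter_from D C --> (1%g : subgroup G).
  by move=> /[apply] -[[F e] [/= Ff e0] CU]; exists F, e; split.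
apply: initial_cvg; apply: initial_cvg; apply: ptws_cvg => x.
apply/cvgrPdist_lt => e e0.
by exists ([set x], e) => [|g /=]; [split=> //; exact: finite_set1 | exact].
Qed.

Lemma subgroup_mulE (g h : subgroup G) x : val (g * h)%g x = val g (val h x).
Proof. by []. Qed.

Context (A : set_system X).

Definition attracting : set_system (subgroup G) :=
  filter_from [set t : set X * set X * R |
      [/\ finite_set t.1.1, A t.1.2 & 0 < t.2]]
    (fun t => [set g : subgroup G | val g @` t.1.1 `<=` mball t.1.2 t.2]).

Lemma attracting_mem (F B : set X) (e : R) :
  finite_set F -> A B -> 0 < e ->
  \forall g \near attracting, val (g : subgroup G) @` F `<=` mball B e.
Proof. by move=> Ff AB e0; exists (F, B, e). Qed.

Lemma attracting_filter : Filter A -> Filter attracting.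
Proof.
move=> FA; apply: filter_from_filter.
  by exists (set0, setT, 1); split => //=; exact: filterT.
move=> [[F1 B1] e1] [[F2 B2] e2] [/= F1f AB1 e10] [/= F2f AB2 e20].
exists (F1 `|` F2, B1 `&` B2, Num.min e1 e2).
  by split => /=; [rewrite finite_setU | exact: filterI | rewrite lt_min e10].
move=> g /= gF; split => _ [x Fx <-].
- have [|b [Bb _] xb] := gF (val g x); first by exists x => //; left.
  by exists b => //; apply: lt_le_trans xb _; rewrite ge_min lexx.
- have [|b [_ Bb] xb] := gF (val g x); first by exists x => //; right.
  by exists b => //; apply: lt_le_trans xb _; rewrite ge_min lexx orbT.
Qed.

Lemma attracting_proper_filter : Filter A -> attractive_filter G A ->
  ProperFilter attracting.
Proof.
move=> /attracting_filter FA attr; apply: filter_from_proper => //.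
move=> [[F B] e] [/= Ff AB e0].
by have [g gF] := attr B AB e F e0 Ff; exists g.
Qed.

(** To bring [g h] close to [B] it suffices to bring [h] close to the
[e / 2]-neighborhood of [g^-1 B], a member of [A] by approximate invariance. *)
Lemma attracting_translate (g : subgroup G) :
  Filter A -> approx_invariant G A ->
  attracting `<=` (fun x => g * x)%g @ attracting.
Proof.
move=> /attracting_filter FA inv C [[[F B] e] [/= Ff AB e0] FBC].
have e20 : 0 < e / 2 by rewrite divr_gt0.
have := attracting_mem Ff (inv B g^-1%g (e / 2) AB e20) e20.
apply: (filterS (F := attracting)) => h hF; apply: FBC => _ [x Fx <-].
have [|a [_ [b Bb <-] ab] xa] := hF (val h x); first by exists x.
exists b => //.
have -> : b = val g (val g^-1%g b) by rewrite -subgroup_mulE mulgV.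
rewrite subgroup_mulE iso_mdist (le_lt_trans (metric_triangle _ a _))//.
by rewrite (splitr e) ltrD.
Qed.

(** The displacement of [y] under [(g x)^-1 (h x)] equals the distance from
[g x y] to [h x y]; with [b] a point close to [x y] at which [g] and [h] nearly
agree, go through [g b] and [h b]. *)
Lemma attracting_approximated (g h : subgroup G) : Filter A ->
  (forall e : R, 0 < e -> exists2 B : set X, A B &
      (ereal_sup [set (mdist (val g x) (val h x))%:E | x in B] < e%:E)%E) ->
  forall U, nbhs (1%g : subgroup G) U ->
    \forall x \near attracting, U ((g * x)^-1 * (h * x))%g.
Proof.
move=> /attracting_filter FA gh U /subgroup_nbhs1[F [e [Ff e0 FU]]].
have e30 : 0 < e / 3 by rewrite divr_gt0.
have [B AB Bgh] := gh _ e30.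
have := attracting_mem Ff AB e30.
apply: (filterS (F := attracting)) => x xF; apply: FU => y Fy.
have [|b Bb yb] := xF (val x y); first by exists y.
have ghb : mdist (val g b) (val h b) < e / 3.
  rewrite -lte_fin; apply: le_lt_trans Bgh.
  by apply: ereal_sup_ubound; exists b.
rewrite -(iso_mdist (val (g * x)%g)) -(subgroup_mulE (g * x)%g) mulVKg.
rewrite !subgroup_mulE (le_lt_trans (metric_triangle _ (val g b) _))//.
rewrite iso_mdist; have -> : e = e / 3 + (e / 3 + e / 3) by field.
rewrite ltrD// (le_lt_trans (metric_triangle _ (val h b) _))// ltrD//.
by rewrite iso_mdist metric_sym.
Qed.

End IsometryGroup.

Theorem proposition7p12 (R : realType) (X : metricType R)
    (G : groupClosed (Iso X)) (A : set_system X)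
    (H : topologicalGroupType) (psi : {multiplicative H -> subgroup G}) :
  Filter A ->
  attractive_filter G A ->
  approx_invariant G A ->
  amenable R H ->
  balanced psi ->
  approximated A (range psi) ->
  skew_amenable R (subgroup G).
Proof.
move=> FA attr inv Ham bal app.
apply: (skew_amenable_of_balanced (attracting_proper_filter FA attr) Ham bal).
- by move=> h; exact: attracting_translate.
- move=> g; have [_ [h _ <-] gh] := app g.
  by exists h; exact: attracting_approximated.
Qed.
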